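(* Fix an integer $t\geq1$ and real numbers $0<p\leq q<1$. Let $k=k(n)\leq\ell=\ell(n)$ be integers satisfying $p_n=\frac kn\to p$ and $q_n=\frac\ell n\to q$ as $n\to\infty$. Then, as $n\to\infty$, $$\mu_\ell(\partial_{k\to\ell}\mathcal S_{n,k}^{(t)})-\Theta_{p_n,q_n}(\mu_k(\mathcal S_{n,k}^{(t)}))\to0,$$ $$\mu_\ell(\partial_{k\to\ell}\mathcal V_{n,k}^{(t)})-\Theta_{p_n,q_n}(\mu_k(\mathcal V_{n,k}^{(t)}))\to0,$$ $$\mu_\ell(\partial_{k\to\ell}\mathcal U_{n,k}^{(t)})-\Theta_{p_n,q_n}(\mu_k(\mathcal U_{n,k}^{(t)}))\to0.$$ Thus $\mathcal S_{n,k}^{(t)}$ for $t\geq2$, $\mathcal V_{n,k}^{(t)}$ for $t\geq1$, and $\mathcal U_{n,k}^{(t)}$ for $t\geq1$ asymptotically attain the first, middle, and third branches of $\Theta$, respectively.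
   Context: $[n]=\{1,\ldots,n\}$ and $\binom{[n]}k$ is the collection of all $k$-element subsets of $[n]$. For $\mathcal F\subseteq\binom{[n]}k$, $\mu_k(\mathcal F)=|\mathcal F|/\binom nk$, and for $k\le\ell\le n$ the upper $\ell$-shadow is $\partial_{k\to\ell}\mathcal F=\{B\in\binom{[n]}\ell:A\subseteq B\text{ for some }A\in\mathcal F\}$. For $n\ge t+1$, $$\mathcal S_{n,k}^{(t)}=\{A\in\tbinom{[n]}k:[t]\subseteq A\},\quad \mathcal V_{n,k}^{(t)}=\{A\in\tbinom{[n]}k:1\in A,\ A\cap\{2,\dots,t+1\}\neq\varnothing\},\quad \mathcal U_{n,k}^{(t)}=\{A\in\tbinom{[n]}k:A\cap[t]\neq\varnothing\}.$$ For $0<p\leq q<1$ the function $\Theta_{p,q}:[0,1]\to[0,1]$ is $$\Theta_{p,q}(x)=\begin{cases} x^{\frac{\log q}{\log p}}, &0\leq x\leq p^2\ \text{(first branch)},\\ q\left[1-\left(1-\frac{x}{p}\right)^{\frac{\log(1-q)}{\log(1-p)}}\right], &p^2\leq x\leq p\ \text{(middle branch)},\\ 1-(1-x)^{\frac{\log(1-q)}{\log(1-p)}}, &p\leq x\leq1\ \text{(third branch)}.\end{cases}$$ A sequence of families $\mathcal F_n\subseteq\binom{[n]}{k}$ asymptotically attains a branch if $\mu_\ell(\partial_{k\to\ell}\mathcal F_n)-\Theta_{p_n,q_n}(\mu_k(\mathcal F_n))\to0$ and $\mu_k(\mathcal F_n)$ converges to a limit lying in the interval of $x$ belonging to that branch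 of $\Theta_{p,q}$. (Since $p_n\to p\in(0,1)$ and $q_n\to q\in(0,1)$, all quantities are defined for all large $n$.) *)

(* Defs.v *)
From mathcomp Require Import all_boot all_order all_algebra.
Set Implicit Arguments.
Unset Strict Implicit.
Unset Printing Implicit Defensive.

Section Families.
Variable n : nat.

(* The ground set [n] = {1, ..., n} is 'I_n, where the ordinal i stands for the
   integer i.+1.  Segments are truncated at n, so famS, famV and famU carry
   their usual meaning for n >= t.+1. *)
Definition segment (a b : nat) : {set 'I_n} := [set i : 'I_n | a <= i.+1 <= b].

Definition layer (k : nat) : {set {set 'I_n}} :=
  [set A : {set 'I_n} | #|A| == k].

Definition upper_shadow (l : nat) (F : {set {set 'I_n}}) : {set {set 'I_n}} :=
  [set B in layer l | [exists A in F, A \subset B]].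

Definition famS (k t : nat) : {set {set 'I_n}} :=
  [set A in layer k | segment 1 t \subset A].

Definition famV (k t : nat) : {set {set 'I_n}} :=
  [set A in layer k |
    (segment 1 1 \subset A) && (A :&: segment 2 t.+1 != set0)].

Definition famU (k t : nat) : {set {set 'I_n}} :=
  [set A in layer k | A :&: segment 1 t != set0].

End Families.

From mathcomp Require Import all_classical all_reals all_analysis.
From mathcomp Require Import ring lra.
Import Order.TTheory GRing.Theory Num.Theory.
Import numFieldNormedType.Exports.
Local Open Scope ring_scope.

Definition mu (R : realType) (n k : nat) (F : {set {set 'I_n}}) : R :=
  #|F|%:R / 'C(n, k)%:R.

Variant branch := FirstBranch | MiddleBranch | ThirdBranch.

Definition branch_interval (R : realType) (b : branch) (p : R) : interval R :=
  match b with
  | FirstBranch => `[0, p ^+ 2]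
  | MiddleBranch => `[p ^+ 2, p]
  | ThirdBranch => `[p, 1]
  end.

Definition branch_fun (R : realType) (b : branch) (p q x : R) : R :=
  match b with
  | FirstBranch => x `^ (ln q / ln p)
  | MiddleBranch => q * (1 - (1 - x / p) `^ (ln (1 - q) / ln (1 - p)))
  | ThirdBranch => 1 - (1 - x) `^ (ln (1 - q) / ln (1 - p))
  end.

Definition Theta (R : realType) (p q x : R) : R :=
  if x <= p ^+ 2 then branch_fun FirstBranch p q x
  else if x <= p then branch_fun MiddleBranch p q x
  else branch_fun ThirdBranch p q x.

(* The branches agree at the shared endpoints p ^+ 2 and p. *)
Lemma ThetaE (R : realType) (b : branch) (p q x : R) :
  0 < p -> p <= q -> q < 1 -> x \in branch_interval b p ->
  Theta p q x = branch_fun b p q x.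
Proof.
move=> p0 pq q1; have p1 : p < 1 by exact: le_lt_trans pq q1.
have q0 : 0 < q by exact: lt_le_trans p0 pq.
have p2p : p ^+ 2 < p by nra.
have powln (a c : R) : 0 < a -> a < 1 -> 0 < c -> a `^ (ln c / ln a) = c.
  move=> a0 a1 c0; rewrite /powR gt_eqF// divfK ?lnK// lt_eqF//.
  by rewrite ln_lt0// a0.
have pE : p `^ (ln q / ln p) = q by exact: powln.
have p1E : (1 - p) `^ (ln (1 - q) / ln (1 - p)) = 1 - q.
  by apply: powln; lra.
have e0 : ln (1 - q) / ln (1 - p) != 0.
  by rewrite mulf_neq0 ?invr_eq0 ?lt_eqF ?ln_lt0//; apply/andP; split; lra.
have mid : q * (1 - (1 - p / p) `^ (ln (1 - q) / ln (1 - p))) = q.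
  by rewrite divff ?gt_eqF// subrr powR0// subr0 mulr1.
rewrite /Theta; case: b; rewrite /branch_interval in_itv /= => /andP[xl xr].
- by rewrite xr.
- rewrite xr; case: ifPn => // x2.
  have -> : x = p ^+ 2 by apply/eqP; rewrite eq_le x2 xl.
  rewrite [in RHS]expr2 mulfK ?gt_eqF// p1E expr2 powRM ?ltW// pE; ring.
- rewrite leNgt (lt_le_trans p2p xl) /=; case: ifPn => // xp.
  have -> : x = p by apply/eqP; rewrite eq_le xp xl.
  by rewrite mid p1E; ring.
Qed.

Definition density (R : realType) (k : nat -> nat) (n : nat) : R :=
  (k n)%:R / n%:R.

Definition Theta_gap (R : realType) (k l : nat -> nat)
    (F : forall n, {set {set 'I_n}}) (n : nat) : R :=
  mu R (l n) (upper_shadow (l n) (F n))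
    - Theta (density R k n) (density R l n) (mu R (k n) (F n)).

Local Open Scope classical_set_scope.

(* p is the limit of k n / n; the interval of a branch does not depend on q. *)
Definition asymptotically_attains (R : realType) (b : branch) (p : R)
    (k l : nat -> nat) (F : forall n, {set {set 'I_n}}) : Prop :=
  [/\ forall n, F n \subset layer n (k n),
      Theta_gap R k l F n @[n --> \oo] --> (0 : R)
    & exists2 x : R, mu R (k n) (F n) @[n --> \oo] --> x
                   & x \in branch_interval b p].

(* Main.v *)
(* The sets of size k that contain X and avoid Y number
   'C(n - |X| - |Y|, k - |X|), a proportion tending to p^|X| (1 - p)^|Y|; so
   mu_k of S, U and V tends to p^t, 1 - (1 - p)^t and p (1 - (1 - p)^t).  For
   large n the upper l-shadow of each family is the same family at level l, so
   its measure has the same limit with q for p, and that limit is the value at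
   mu_k of the corresponding branch of Theta.  To see that Theta is eventually
   evaluated on the intended branch, compare S with S^(2), whose density
   (k/n) ((k-1)/(n-1)) is at most (k/n)^2, and U and V with S^(1), whose density
   is k/n.  For t > 1 the lower bound p^2 on V comes from its limit
   p (1 - (1 - p)^t) > p^2.  At t = 1, U = S^(1) and V = S^(2). *)
Require Import Defs.
From mathcomp Require Import all_boot all_order all_algebra.

(** * Counting sets that contain [X] and avoid [Y] *)

(** Adding [X] is a bijection from the subsets of size [k - #|X|] of the complement of [X :|: Y]
    onto the sets counted. The bound [#|X| <= k] guards the truncated subtraction: below it no set
    qualifies, yet 'C(m, 0) = 1. *)
Lemma card_draws_between (T : finType) (X Y : {set T}) (k : nat) :
    [disjoint X & Y] -> #|X| <= k ->
  #|[set A : {set T} | [&& #|A| == k, X \subset A & [disjoint A & Y]]]|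
    = 'C(#|T| - #|X| - #|Y|, k - #|X|).
Proof.
move=> dXY leXk; have cXY : #|~: (X :|: Y)| = #|T| - #|X| - #|Y|.
  by rewrite [LHS]cardsCs setCK cardsU (disjoint_setI0 dXY) cards0 subn0 subnDA.
rewrite -cXY -cards_draws -[RHS](card_in_imset (f := fun A => A :|: X));
  last first.
  move=> A B; rewrite !inE => /andP[/subsetP AXY _] /andP[/subsetP BXY _].
  move=> /setP e.
  apply/setP => x; move: (e x) (AXY x) (BXY x); rewrite !inE.
  by case: (x \in A); case: (x \in B); case: (x \in X) => //= _ h1 h2;
    [case: (h1 isT) | case: (h2 isT)].
apply: eq_card => A; apply/idP/imsetP => [|[D]]; rewrite !inE.
  case/and3P => /eqP cA sXA dAY; exists (A :\: X); last first.
    by rewrite setDE setUIl setUC (setUC _ X) setUCr setIT; apply/esym/setUidPr.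
  rewrite inE cardsD (setIidPr sXA) cA eqxx andbT.
  apply/subsetP => x; rewrite !inE negb_or => /andP[-> xA] /=.
  by rewrite (disjointFr dAY xA).
case/andP => /subsetP sD /eqP cD ->.
have dDX : D :&: X = set0.
  apply/setP => x; rewrite !inE; apply/negP => /andP[/sD].
  by rewrite !inE negb_or => /andP[/negbTE ->].
rewrite cardsU dDX cards0 subn0 cD subnK// eqxx subsetUr /=.
apply/pred0P => x /=; rewrite !inE; apply/negP => /andP[/orP[/sD xD|xX] xY].
  by rewrite !inE xY orbT in xD.
by rewrite (disjointFr dXY xX) in xY.
Qed.

(** Existence by counting: with [Y] the complement of [B], the number of such sets is a binomial
    coefficient 'C(|B| - |X|, k - |X|), which is positive. *)
Lemma exists_card_between (T : finType) (X B : {set T}) (k : nat) :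
    X \subset B -> #|X| <= k <= #|B| ->
  exists A : {set T}, [/\ #|A| = k, X \subset A & A \subset B].
Proof.
move=> sXB /andP[leXk lekB].
have dX : [disjoint X & ~: B] by rewrite -subsets_disjoint.
have := card_draws_between T X (~: B) k dX leXk.
have -> : #|T| - #|X| - #|~: B| = #|B| - #|X|.
  by rewrite subnAC -[#|T|](cardsC B) addnK.
move=> e; have : 0 < 'C(#|B| - #|X|, k - #|X|) by rewrite bin_gt0 leq_sub2r.
rewrite -e card_gt0 => /set0Pn[A]; rewrite inE -subsets_disjoint.
by case/and3P => /eqP ? ? ?; exists A.
Qed.

Lemma card_segment (n a b : nat) :
  0 < a -> b <= n -> #|segment n a b| = b.+1 - a.
Proof.
have card1 c : c <= n -> #|segment n 1 c| = c.
  move=> cn; rewrite -[RHS]card_ord -!sum1_card (big_ord_widen _ (fun=> 1) cn).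
  by apply: eq_bigl => i; rewrite inE.
case: a => // a _ bn; rewrite subSS; case: (leqP a b) => [ab|ba].
  (* A general segment is the difference of two nested initial segments. *)
  have -> : segment n a.+1 b = segment n 1 b :\: segment n 1 a.
    by apply/setP => i; rewrite !inE /= -leqNgt ltnS.
  rewrite cardsD (setIidPr _) ?card1 ?(leq_trans ab)//.
  by apply/subsetP => i; rewrite !inE /= => /leq_trans ->.
apply/eqP; rewrite (eqnP (ltnW ba)) cards_eq0; apply/eqP/setP => i.
by rewrite !inE; apply/negP => /andP[/leq_trans h /h]; rewrite ltnNge ltnW.
Qed.

(** * Upper shadows of the three families *)

(** Inside a set [B] with [P], a witness [X] of size at most [k] is padded to size exactly [k]
    without leaving [B]; upward closure keeps [P] along the way. The families S, U and V have
    witnesses of size t, 1 and 2. *)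
Lemma upper_shadow_up_closed (n k l : nat) (P : pred {set 'I_n}) :
    k <= l -> (forall A B : {set _}, A \subset B -> P A -> P B) ->
    (forall B, P B ->
       exists2 X : {set 'I_n}, P X & (X \subset B) && (#|X| <= k)) ->
  upper_shadow l [set A in layer n k | P A] = [set B in layer n l | P B].
Proof.
move=> kl upP wP; apply/setP => B; rewrite !inE.
case: eqVneq => //= cB; apply/existsP/idP => [[A]|/wP[X PX /andP[XB cX]]].
  by rewrite !inE => /andP[/andP[_ PA]] /upP; apply.
have [|A [cA XA AB]] := exists_card_between _ _ _ k XB; first by rewrite cX cB.
by exists A; rewrite !inE cA eqxx AB (upP _ _ XA).
Qed.

Lemma upper_shadow_famS (n k l t : nat) : t <= k -> k <= l -> t <= n ->
  upper_shadow l (famS n k t) = famS n l t.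
Proof.
move=> tk kl tn; apply: upper_shadow_up_closed => // [A B AB /subset_trans|B tB].
  exact.
by exists (segment n 1 t); rewrite // tB card_segment// subn1.
Qed.

Lemma upper_shadow_famU (n k l t : nat) : 0 < k -> k <= l ->
  upper_shadow l (famU n k t) = famU n l t.
Proof.
move=> k0 kl; apply: upper_shadow_up_closed => // [A B AB|B].
  by apply: contraNneq => e; rewrite -subset0 -e setSI.
case/set0Pn => i /setIP[iB it]; exists [set i]; last by rewrite cards1 sub1set iB.
by apply/set0Pn; exists i; rewrite !inE eqxx; rewrite inE in it.
Qed.

Lemma upper_shadow_famV (n k l t : nat) : 1 < k -> k <= l -> 0 < n ->
  upper_shadow l (famV n k t) = famV n l t.
Proof.
move=> k0 kl n0; apply: upper_shadow_up_closed => // [A B AB|B].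
  case/andP => /subset_trans -> //=.
  by apply: contraNneq => e; rewrite -subset0 -e setSI.
case/andP => sB /set0Pn[i /setIP[iB it]].
(* The witness is {1, i} with i in {2, ..., t+1}; it has at most two elements, whence [1 < k]. *)
exists (i |: segment n 1 1).
  by rewrite subsetUr; apply/set0Pn; exists i; rewrite !inE eqxx; rewrite inE in it.
rewrite subUset sub1set iB sB cardsU1 card_segment// (leq_trans _ k0)//.
by rewrite (@leq_add _ 1 1 1)// leq_b1.
Qed.

(** * Cardinalities, and coincidences at t = 1 *)

Lemma card_famS (n k t : nat) : t <= k -> t <= n ->
  #|famS n k t| = 'C(n - t, k - t).
Proof.
move=> tk tn; have cS : #|segment n 1 t| = t by rewrite card_segment// subn1.
have := card_draws_between _ (segment n 1 t) set0 k.
rewrite cards0 subn0 cS card_ord => <- //; last first.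
  by rewrite disjoint_sym disjoints_subset sub0set.
by apply: eq_card => A; rewrite !inE disjoint_sym disjoints_subset sub0set andbT.
Qed.

(** The complement of U in the layer consists of the sets avoiding [t]. The additive form postpones
    subtraction to the reals. *)
Lemma card_famU (n k t : nat) : t <= n ->
  #|famU n k t| + 'C(n - t, k) = 'C(n, k).
Proof.
move=> tn; have cS : #|segment n 1 t| = t by rewrite card_segment// subn1.
have := card_draws_between _ set0 (segment n 1 t) k.
rewrite cards0 !subn0 cS card_ord => <- //; last first.
  by rewrite disjoints_subset sub0set.
rewrite -[X in _ = 'C(X, _)](card_ord n) -card_draws.
rewrite -[RHS](cardsID [set A | A :&: segment n 1 t != set0]).
congr (_ + _); apply: eq_card => A; rewrite !inE //.
by rewrite sub0set /= -setI_eq0 negbK andbC.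
Qed.

(** Among the sets containing 1, those outside V avoid {2, ..., t+1}: this is the count with [X] =
    {1} and [Y] = {2, ..., t+1}. *)
Lemma card_famV (n k t : nat) : 0 < k -> t < n ->
  #|famV n k t| + 'C(n - 1 - t, k - 1) = 'C(n - 1, k - 1).
Proof.
move=> k0 tn; have n0 : 0 < n by exact: leq_ltn_trans tn.
have c1 : #|segment n 1 1| = 1 by rewrite card_segment.
have ct : #|segment n 2 t.+1| = t by rewrite card_segment// subSS subn1.
have d : [disjoint segment n 1 1 & segment n 2 t.+1].
  apply/pred0P => i /=; rewrite !inE; apply/negP => /andP[i1 /andP[i2 _]].
  by have := leq_trans i2 i1.
have := card_draws_between _ (segment n 1 1) (segment n 2 t.+1) k d.
rewrite c1 ct card_ord => <- //; rewrite -card_famS//.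
rewrite -[RHS](cardsID [set A | A :&: segment n 2 t.+1 != set0] (famS n k 1)).
congr (_ + _); apply: eq_card => A; rewrite !inE ?andbA //.
by rewrite -setI_eq0 negbK -[RHS]andbA andbC.
Qed.

Lemma famU1 (n k : nat) : 0 < n -> famU n k 1 = famS n k 1.
Proof.
case: n => // n _; apply/setP => A; rewrite !inE; congr (_ && _).
have -> : segment n.+1 1 1 = [set ord0].
  by apply/setP => i; rewrite !inE /= -val_eqE /= ltnS leqn0.
by rewrite sub1set setIC setI_eq0 disjoints_subset sub1set inE negbK.
Qed.

Lemma famV1 (n k : nat) : 1 < n -> famV n k 1 = famS n k 2.
Proof.
case: n => [|[|n]]// _; apply/setP => A; rewrite !inE; congr (_ && _).
have -> : segment n.+2 1 2 = segment n.+2 1 1 :|: segment n.+2 2 2.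
  by apply/setP => -[[|[|i]] ?]; rewrite !inE.
have -> : segment n.+2 2 2 = [set lift ord0 ord0].
  by apply/setP => -[[|[|i]] ?]; rewrite !inE -val_eqE.
by rewrite subUset sub1set setIC setI_eq0 disjoints_subset sub1set inE negbK.
Qed.

Lemma famV_sub_famS1 (n k t : nat) : famV n k t \subset famS n k 1.
Proof. by apply/subsetP => A; rewrite !inE => /and3P[-> ->]. Qed.

Lemma famS_le_sub (n k s t : nat) : s <= t -> famS n k t \subset famS n k s.
Proof.
move=> st; apply/subsetP => A; rewrite !inE => /andP[-> /subsetP tA] /=.
by apply/subsetP => i; rewrite inE /= => i_s; apply: tA; rewrite inE /= (leq_trans i_s).
Qed.
From mathcomp Require Import all_classical all_reals all_analysis.
From mathcomp Require Import ring lra zify.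
Import Order.TTheory GRing.Theory Num.Theory.
Import numFieldNormedType.Exports.
Local Open Scope ring_scope.
Local Open Scope classical_set_scope.

(** * Asymptotics of binomial ratios *)

Lemma bin_pred_diag (R : realType) (N K : nat) : (0 < K <= N)%N ->
  'C(N - 1, K - 1)%:R = K%:R / N%:R * 'C(N, K)%:R :> R.
Proof.
move=> /andP[K0 KN]; have N0 : N%:R != 0 :> R by rewrite pnatr_eq0; lia.
have := mul_bin_diag N (K - 1); rewrite subn1 [in K.-1.+1]prednK// -subn1.
move=> /(congr1 (fun i => i%:R : R)); rewrite !natrM => e.
by apply: (mulfI N0); rewrite !subn1 in e *; rewrite e mulrA mulrCA divff// mulr1.
Qed.

Lemma bin_pred_down (R : realType) (N K : nat) : (0 < N)%N ->
  'C(N - 1, K)%:R = (N - K)%:R / N%:R * 'C(N, K)%:R :> R.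
Proof.
move=> N0; have N0' : N%:R != 0 :> R by rewrite pnatr_eq0; lia.
have := mul_bin_down N K.
move=> /(congr1 (fun i => i%:R : R)); rewrite !natrM => e.
by apply: (mulfI N0'); rewrite !subn1 in e *; rewrite e mulrA mulrCA divff// mulr1.
Qed.

(** Supplies the inequalities on naturals that make truncated subtractions exact and binomial
    coefficients nonzero for large n. *)
Lemma near_density_bounds (R : realType) (m : nat -> nat) (p : R) (s : nat) :
    0 < p -> p < 1 -> density R m n @[n --> \oo] --> p ->
  \forall n \near \oo, (s <= m n)%N /\ (s + m n <= n)%N.
Proof.
move=> p0 p1 mp.
have lo : p / 2 < p by lra.
have hi : p < (1 + p) / 2 by lra.
near=> n.
have n0 : (0 : R) < n%:R by rewrite ltr0n; near: n; exact: nbhs_infty_gt.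
have mE : (m n)%:R = density R m n * n%:R by rewrite /density divfK// gt_eqF.
have dlo : p / 2 < density R m n by near: n; exact: (cvgr_gt p mp).
have dhi : density R m n < (1 + p) / 2 by near: n; exact: (cvgr_lt p mp).
(* Eventually m n >= n p/2 and n - m n >= n (1 - p)/2, so both exceed s once n passes these two
   thresholds. *)
have nlo : s%:R / (p / 2) < n%:R by near: n; exact: nbhs_infty_gtr.
have nhi : s%:R / ((1 - p) / 2) < n%:R by near: n; exact: nbhs_infty_gtr.
rewrite ltr_pdivrMr in nlo; last by lra.
rewrite ltr_pdivrMr in nhi; last by lra.
rewrite -(ltr_pM2r n0) in dlo; rewrite -(ltr_pM2r n0) in dhi.
by split; rewrite -(ler_nat R) ?natrD mE; lra.
Unshelve. all: by end_near.
Qed.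

Lemma cvg_density_shift (R : realType) (m : nat -> nat) (p a c : R) :
    density R m n @[n --> \oo] --> p ->
  ((m n)%:R - a) / (n%:R - c) @[n --> \oo] --> p.
Proof.
move=> mp.
have V0 (b : R) : b / n%:R @[n --> \oo] --> 0.
  rewrite -[X in _ --> X](mulr0 b); apply: cvgM; first exact: cvg_cst.
  apply/gtr0_cvgV0; last exact: cvgr_idn.
  by near=> n; rewrite ltr0n; near: n; exact: nbhs_infty_gt.
(* Numerator and denominator are divided by n, so that the shifts vanish in the limit. *)
have : (density R m n - a / n%:R) / (1 - c / n%:R) @[n --> \oo] --> (p - 0) / (1 - 0).
  apply: cvgM; first exact: cvgB.
  apply: cvgV; first by rewrite subr0 oner_neq0.
  by apply: cvgB => //; exact: cvg_cst.
rewrite !subr0 divr1; apply: cvg_trans; apply: near_eq_cvg; near=> n => /=.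
have n0 : (n%:R : R) != 0.
  by rewrite gt_eqF// ltr0n; near: n; exact: nbhs_infty_gt.
have nc : n%:R - c != 0.
  by rewrite gt_eqF// subr_gt0; near: n; exact: nbhs_infty_gtr.
by rewrite /density; field; rewrite nc.
Unshelve. all: by end_near.
Qed.

Lemma cvg_density_compl (R : realType) (m : nat -> nat) (p : R) :
    0 < p -> p < 1 -> density R m n @[n --> \oo] --> p ->
  density R (fun n => n - m n)%N n @[n --> \oo] --> 1 - p.
Proof.
move=> p0 p1 mp.
have : 1 - density R m n @[n --> \oo] --> 1 - p.
  by apply: cvgB => //; exact: cvg_cst.
apply: cvg_trans; apply: near_eq_cvg; near=> n => /=.
have [n0 nm] : (0 < n)%N /\ (0 + m n <= n)%N.
  split; near: n; first exact: nbhs_infty_gt.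
  by apply: filterS (near_density_bounds _ _ _ 0 p0 p1 mp) => n [].
by rewrite /density natrB// mulrBl divff// pnatr_eq0 -lt0n.
Unshelve. all: by end_near.
Qed.

(** Elements are removed one at a time. Forcing one more element in multiplies the ratio by (m n -
    a)/(n - a), which tends to p; forcing one more out multiplies it by (n - m n - b)/(n - a - b),
    which tends to 1 - p. The induction on [a] is done at b = 0, inside the base case of the
    induction on [b]. *)
Lemma cvg_bin_ratio (R : realType) (m : nat -> nat) (p : R) (a b : nat) :
    0 < p -> p < 1 -> density R m n @[n --> \oo] --> p ->
  'C(n - a - b, m n - a)%:R / 'C(n, m n)%:R @[n --> \oo]
    --> p ^+ a * (1 - p) ^+ b.
Proof.
move=> p0 p1 mp; elim: b => [|b IHb].
  elim: a => [|a IHa].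
    rewrite !expr0 mulr1; have : (1 : R) @[n --> \oo] --> (1 : R) by exact: cvg_cst.
    apply: cvg_trans; apply: near_eq_cvg; near=> n => /=.
    have [_ nm] : (0 <= m n)%N /\ (0 + m n <= n)%N.
      by near: n; exact: (near_density_bounds _ _ _ _ p0 p1 mp).
    by rewrite !subn0 divff// pnatr_eq0 -lt0n bin_gt0.
  rewrite exprS -mulrA.
  apply: cvg_trans (cvgM (cvg_density_shift _ _ _ a%:R a%:R mp) IHa).
  apply: near_eq_cvg; near=> n => /=.
  have [am nm] : (a.+1 <= m n)%N /\ (a.+1 + m n <= n)%N.
    by near: n; exact: (near_density_bounds _ _ _ _ p0 p1 mp).
  rewrite !subn0 -(addn1 a) !subnDA bin_pred_diag; last by lia.
  by rewrite !natrB ?mulrA//; lia.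
have mp' := cvg_density_compl _ _ _ p0 p1 mp.
rewrite exprS mulrCA.
apply: cvg_trans (cvgM (cvg_density_shift _ _ _ b%:R (a + b)%:R mp') IHb).
apply: near_eq_cvg; near=> n => /=.
have [am nm] : (a + b.+1 <= m n)%N /\ (a + b.+1 + m n <= n)%N.
  by near: n; exact: (near_density_bounds _ _ _ _ p0 p1 mp).
rewrite -(addn1 b) !subnDA bin_pred_down; last by lia.
rewrite mulrA; congr (_ / _ * _ / _); first by rewrite -natrB; [congr _%:R; lia|lia].
by rewrite -natrB; [congr _%:R; lia|lia].
Unshelve. all: by end_near.
Qed.

(** * Measures of the families: limits and comparisons with the breakpoints *)

Lemma cvg_mu_famS (R : realType) (m : nat -> nat) (p : R) (t : nat) :
    0 < p -> p < 1 -> density R m n @[n --> \oo] --> p ->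
  mu R (m n) (famS n (m n) t) @[n --> \oo] --> p ^+ t.
Proof.
move=> p0 p1 mp.
have := cvg_bin_ratio _ _ _ t 0 p0 p1 mp; rewrite expr0 mulr1.
apply: cvg_trans; apply: near_eq_cvg; near=> n => /=.
have [tm nm] : (t <= m n)%N /\ (t + m n <= n)%N.
  by near: n; exact: (near_density_bounds _ _ _ _ p0 p1 mp).
by rewrite /mu card_famS ?subn0//; lia.
Unshelve. all: by end_near.
Qed.

Lemma cvg_mu_famU (R : realType) (m : nat -> nat) (p : R) (t : nat) :
    0 < p -> p < 1 -> density R m n @[n --> \oo] --> p ->
  mu R (m n) (famU n (m n) t) @[n --> \oo] --> 1 - (1 - p) ^+ t.
Proof.
move=> p0 p1 mp.
have : 1 - 'C(n - 0 - t, m n - 0)%:R / 'C(n, m n)%:R @[n --> \oo]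
    --> 1 - p ^+ 0 * (1 - p) ^+ t.
  by apply: cvgB; [exact: cvg_cst | exact: cvg_bin_ratio].
rewrite expr0 mul1r; apply: cvg_trans; apply: near_eq_cvg; near=> n => /=.
have [tm nm] : (t <= m n)%N /\ (t + m n <= n)%N.
  by near: n; exact: (near_density_bounds _ _ _ _ p0 p1 mp).
have c0 : ('C(n, m n)%:R : R) != 0 by rewrite pnatr_eq0 -lt0n bin_gt0; lia.
apply: (mulIf c0); rewrite /mu mulrBl !divfK// mul1r !subn0.
by rewrite -(@card_famU n (m n) t) ?natrD ?addrK//; lia.
Unshelve. all: by end_near.
Qed.

Lemma cvg_mu_famV (R : realType) (m : nat -> nat) (p : R) (t : nat) :
    0 < p -> p < 1 -> density R m n @[n --> \oo] --> p ->
  mu R (m n) (famV n (m n) t) @[n --> \oo] --> p * (1 - (1 - p) ^+ t).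
Proof.
move=> p0 p1 mp.
have : 'C(n - 1 - 0, m n - 1)%:R / 'C(n, m n)%:R
    - 'C(n - 1 - t, m n - 1)%:R / 'C(n, m n)%:R @[n --> \oo]
    --> p ^+ 1 * (1 - p) ^+ 0 - p ^+ 1 * (1 - p) ^+ t.
  by apply: cvgB; exact: cvg_bin_ratio.
rewrite expr0 expr1 -mulrBr; apply: cvg_trans; apply: near_eq_cvg; near=> n => /=.
have [tm nm] : (t.+1 <= m n)%N /\ (t.+1 + m n <= n)%N.
  by near: n; exact: (near_density_bounds _ _ _ _ p0 p1 mp).
by rewrite /mu -mulrBl subn0 -(@card_famV n (m n) t) ?natrD ?addrK//; lia.
Unshelve. all: by end_near.
Qed.

(** Equality at finite n locates [mu] relative to the moving breakpoint k/n. For U at t = 1 both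
    tend to p, so limits alone would not decide the branch. *)
Lemma near_mu_famS1 (R : realType) (m : nat -> nat) (p : R) :
    0 < p -> p < 1 -> density R m n @[n --> \oo] --> p ->
  \forall n \near \oo, mu R (m n) (famS n (m n) 1) = density R m n.
Proof.
move=> p0 p1 mp.
near=> n; have [tm nm] : (1 <= m n)%N /\ (1 + m n <= n)%N.
  by near: n; exact: (near_density_bounds _ _ _ _ p0 p1 mp).
rewrite /mu card_famS//; last by lia.
rewrite bin_pred_diag ?mulfK//; last by lia.
by rewrite pnatr_eq0 -lt0n bin_gt0; lia.
Unshelve. all: by end_near.
Qed.

(** For S at t = 2 the measure and the breakpoint (k/n)^2 share the limit p^2, so again a comparison
    at finite n is required. *)
Lemma near_mu_famS2 (R : realType) (m : nat -> nat) (p : R) :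
    0 < p -> p < 1 -> density R m n @[n --> \oo] --> p ->
  \forall n \near \oo, mu R (m n) (famS n (m n) 2) <= density R m n ^+ 2.
Proof.
move=> p0 p1 mp.
near=> n; have [tm nm] : (2 <= m n)%N /\ (2 + m n <= n)%N.
  by near: n; exact: (near_density_bounds _ _ _ _ p0 p1 mp).
rewrite /mu card_famS//; last by lia.
rewrite -[2%N]/(1 + 1)%N !subnDA bin_pred_diag; last by lia.
rewrite bin_pred_diag; last by lia.
rewrite mulrA mulfK; last by rewrite pnatr_eq0 -lt0n bin_gt0; lia.
rewrite expr2 ler_wpM2r ?divr_ge0//.
rewrite ler_pdivrMr ?ltr0n; last by lia.
rewrite mulrAC ler_pdivlMr ?ltr0n; last by lia.
by rewrite -!natrM ler_nat; nia.
Unshelve. all: by end_near.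
Qed.

Lemma mu_subset (R : realType) (n k : nat) (F G : {set {set 'I_n}}) :
  F \subset G -> mu R k F <= mu R k G.
Proof. by move=> FG; rewrite ler_wpM2r ?invr_ge0// ler_nat subset_leq_card. Qed.

Lemma mu_ge0 (R : realType) (n k : nat) (F : {set {set 'I_n}}) : 0 <= mu R k F.
Proof. exact: divr_ge0. Qed.

Lemma mu_le1 (R : realType) (n k : nat) (F : {set {set 'I_n}}) :
  F \subset layer n k -> mu R k F <= 1.
Proof.
move=> /subset_leq_card; rewrite card_draws card_ord => cF.
rewrite /mu; have [->|c0] := posnP 'C(n, k); first by rewrite invr0 mulr0.
by rewrite ler_pdivrMr ?ltr0n// mul1r ler_nat.
Qed.

(** * Joint continuity of the branches *)

(** [powR] treats base 0 separately; since the limit of the base is positive, the power is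
    eventually [expR (e i * ln (x i))], which is continuous in base and exponent together. *)
Lemma cvg_powR (R : realType) (T : Type) (F : set_system T) (FF : Filter F)
    (x e : T -> R) (x0 e0 : R) :
    0 < x0 -> x i @[i --> F] --> x0 -> e i @[i --> F] --> e0 ->
  x i `^ e i @[i --> F] --> x0 `^ e0.
Proof.
move=> x00 xx0 ee0.
have : expR (e i * ln (x i)) @[i --> F] --> expR (e0 * ln x0).
  apply: continuous_cvg; first exact: continuous_expR.
  by apply: cvgM => //; apply: continuous_cvg => //; exact: continuous_ln.
rewrite (_ : x0 `^ e0 = expR (e0 * ln x0)); last by rewrite /powR gt_eqF.
apply: cvg_trans; apply: near_eq_cvg.
near=> i; rewrite /powR gt_eqF//; near: i; exact: (cvgr_gt x0 xx0).
Unshelve. all: by end_near.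
Qed.

Lemma cvg_ln_ratio (R : realType) (T : Type) (F : set_system T) (FF : Filter F)
    (u v : T -> R) (u0 v0 : R) :
    0 < u0 -> 0 < v0 < 1 -> u i @[i --> F] --> u0 -> v i @[i --> F] --> v0 ->
  ln (u i) / ln (v i) @[i --> F] --> ln u0 / ln v0.
Proof.
move=> u00 v01 uu0 vv0; have /andP[v00 v1] := v01.
apply: cvgM; first by apply: continuous_cvg => //; exact: continuous_ln.
apply: cvgV; first by rewrite lt_eqF// ln_lt0.
by apply: continuous_cvg => //; exact: continuous_ln.
Qed.

(* The base of the power must stay positive at the limit: first branch away
   from 0, middle branch away from p, third branch away from 1. *)
Lemma cvg_branch_fun (R : realType) (b : branch) (T : Type) (F : set_system T)
    (FF : Filter F) (pp qq xx : T -> R) (p q x : R) :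
    0 < p < 1 -> 0 < q < 1 ->
    match b with FirstBranch => 0 < x | MiddleBranch => x < p
    | ThirdBranch => x < 1 end ->
    pp i @[i --> F] --> p -> qq i @[i --> F] --> q -> xx i @[i --> F] --> x ->
  branch_fun b (pp i) (qq i) (xx i) @[i --> F] --> branch_fun b p q x.
Proof.
move=> p01 q01 xb ppp qqq xxx.
have /andP[p0 p1] := p01; have /andP[q0 q1] := q01.
have C1 (f : T -> R) (y : R) : f i @[i --> F] --> y -> 1 - f i @[i --> F] --> 1 - y.
  by move=> fy; apply: cvgB => //; exact: cvg_cst.
have lr : ln (1 - qq i) / ln (1 - pp i) @[i --> F] --> ln (1 - q) / ln (1 - p).
  by apply: cvg_ln_ratio; [lra|lra|exact: C1|exact: C1].
case: b xb => /= xb.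
- by apply: cvg_powR => //; apply: cvg_ln_ratio.
- apply: cvgM => //; apply: (C1); apply: cvg_powR => //.
    by rewrite subr_gt0 ltr_pdivrMr// mul1r.
  by apply: (C1); apply: cvgM => //; apply: cvgV => //; rewrite gt_eqF.
- by apply: (C1); apply: cvg_powR => //; [lra|exact: C1].
Qed.

(** Since ln (a^t) = t ln a, the denominator cancels. With a = p, c = q this evaluates the first
    branch at p^t; with a = 1 - p, c = 1 - q it evaluates the other two at the limits of V and U. *)
Lemma powR_expr_ln_ratio (R : realType) (a c : R) (t : nat) :
  0 < a < 1 -> 0 < c -> (a ^+ t) `^ (ln c / ln a) = c ^+ t.
Proof.
move=> a01 c0; have /andP[a0 a1] := a01.
rewrite /powR gt_eqF ?exprn_gt0// lnXn// -mulr_natr mulrA divfK.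
  by rewrite expRM_natr lnK.
by rewrite lt_eqF// ln_lt0.
Qed.

(** * Convergence of the gap on each branch *)

(** Membership in the interval with moving endpoints k/n lets [ThetaE] replace [Theta] by a single
    branch for large n. By joint continuity that branch then has the same limit as the measure of
    the shadow. *)
Lemma Theta_gap_cvg0 (R : realType) (p q : R) (k l : nat -> nat)
    (b : branch) (x : R) (F : forall n, {set {set 'I_n}}) :
    0 < p -> p <= q -> q < 1 -> (forall n : nat, (k n <= l n)%N) ->
    density R k n @[n --> \oo] --> p -> density R l n @[n --> \oo] --> q ->
    match b with FirstBranch => 0 < x | MiddleBranch => x < p
    | ThirdBranch => x < 1 end ->
    mu R (k n) (F n) @[n --> \oo] --> x ->
    (\forall n \near \oo, mu R (k n) (F n) \in branch_interval b (density R k n)) ->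
    mu R (l n) (upper_shadow (l n) (F n)) @[n --> \oo] --> branch_fun b p q x ->
  Theta_gap R k l F n @[n --> \oo] --> 0.
Proof.
move=> hp hpq hq hkl hkp hlq xb Fx Fb sF.
have p1 : p < 1 by exact: le_lt_trans hpq hq.
have q0 : 0 < q by exact: lt_le_trans hp hpq.
have : mu R (l n) (upper_shadow (l n) (F n))
    - branch_fun b (density R k n) (density R l n) (mu R (k n) (F n))
    @[n --> \oo] --> branch_fun b p q x - branch_fun b p q x.
  by apply: cvgB => //; apply: cvg_branch_fun => //; rewrite ?hp ?q0.
rewrite subrr; apply: cvg_trans; apply: near_eq_cvg; near=> n.
rewrite /Theta_gap (@ThetaE _ b)//.
- by near: n; exact: (cvgr_gt p hkp).
- by rewrite /density ler_wpM2r ?invr_ge0// ler_nat.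
- by near: n; exact: (cvgr_lt q hlq).
- by near: n.
Unshelve. all: by end_near.
Qed.

Lemma Theta_gap_famU (R : realType) (p q : R) (k l : nat -> nat) (t : nat) :
    0 < p -> p <= q -> q < 1 -> (forall n : nat, (k n <= l n)%N) ->
    density R k n @[n --> \oo] --> p -> density R l n @[n --> \oo] --> q ->
    (0 < t)%N ->
  Theta_gap R k l (fun n => famU n (k n) t) n @[n --> \oo] --> 0.
Proof.
move=> hp hpq hq hkl hkp hlq t0.
have p1 : p < 1 by exact: le_lt_trans hpq hq.
have q0 : 0 < q by exact: lt_le_trans hp hpq.
apply: (@Theta_gap_cvg0 R p q k l ThirdBranch
  (1 - (1 - p) ^+ t) (fun n => famU n (k n) t) hp hpq hq hkl hkp hlq).
- by rewrite ltrBlDr ltrDl exprn_gt0// subr_gt0.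
- exact: cvg_mu_famU.
- near=> n; rewrite in_itv /=; apply/andP; split; last first.
    by apply: mu_le1; apply/fintype.subsetP => A; rewrite !inE => /andP[].
  have n0 : (0 < n)%N by near: n; exact: nbhs_infty_gt.
  have <- : mu R (k n) (famS n (k n) 1) = density R k n.
    by near: n; exact: (near_mu_famS1 _ _ _ hp p1 hkp).
  apply: mu_subset; rewrite -famU1//; apply/fintype.subsetP => A; rewrite !inE.
  case/andP=> -> /set0Pn[i]; rewrite !inE => /and3P[iA _ i1].
  by apply/set0Pn; exists i; rewrite !inE iA /= (leq_trans i1).
(* At x = 1 - (1 - p)^t the base is (1 - p)^t, so the branch takes the value 1 - (1 - q)^t, the
   limit of the measure of U at level l. *)
rewrite /= subKr powR_expr_ln_ratio; [|lra|lra].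
have := cvg_mu_famU _ _ _ t q0 hq hlq.
apply: cvg_trans; apply: near_eq_cvg; near=> n => /=.
rewrite upper_shadow_famU//.
have [] : (1 <= k n)%N /\ (1 + k n <= n)%N.
  by near: n; exact: (near_density_bounds _ _ _ _ hp p1 hkp).
by [].
Unshelve. all: by end_near.
Qed.

Lemma Theta_gap_famS (R : realType) (p q : R) (k l : nat -> nat) (t : nat) :
    0 < p -> p <= q -> q < 1 -> (forall n : nat, (k n <= l n)%N) ->
    density R k n @[n --> \oo] --> p -> density R l n @[n --> \oo] --> q ->
    (1 < t)%N ->
  Theta_gap R k l (fun n => famS n (k n) t) n @[n --> \oo] --> 0.
Proof.
move=> hp hpq hq hkl hkp hlq t1.
have p1 : p < 1 by exact: le_lt_trans hpq hq.
have q0 : 0 < q by exact: lt_le_trans hp hpq.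
apply: (@Theta_gap_cvg0 R p q k l FirstBranch
  (p ^+ t) (fun n => famS n (k n) t) hp hpq hq hkl hkp hlq).
- exact: exprn_gt0.
- exact: cvg_mu_famS.
- near=> n; rewrite in_itv /= mu_ge0 /=.
  apply: le_trans (mu_subset _ _ _ _ _ (famS_le_sub _ _ _ _ t1)) _.
  by near: n; exact: (near_mu_famS2 _ _ _ hp p1 hkp).
rewrite /= powR_expr_ln_ratio ?hp//.
have := cvg_mu_famS _ _ _ t q0 hq hlq.
apply: cvg_trans; apply: near_eq_cvg; near=> n => /=.
have [tk kn] : (t <= k n)%N /\ (t + k n <= n)%N.
  by near: n; exact: (near_density_bounds _ _ _ _ hp p1 hkp).
by rewrite upper_shadow_famS//; lia.
Unshelve. all: by end_near.
Qed.

Lemma Theta_gap_famV (R : realType) (p q : R) (k l : nat -> nat) (t : nat) :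
    0 < p -> p <= q -> q < 1 -> (forall n : nat, (k n <= l n)%N) ->
    density R k n @[n --> \oo] --> p -> density R l n @[n --> \oo] --> q ->
    (1 < t)%N ->
  Theta_gap R k l (fun n => famV n (k n) t) n @[n --> \oo] --> 0.
Proof.
move=> hp hpq hq hkl hkp hlq t1.
have p1 : p < 1 by exact: le_lt_trans hpq hq.
have q0 : 0 < q by exact: lt_le_trans hp hpq.
have e1 : (1 - p) ^+ t < 1 - p by rewrite ltr_iXnr//; lra.
have e0 : 0 < (1 - p) ^+ t by rewrite exprn_gt0// subr_gt0.
apply: (@Theta_gap_cvg0 R p q k l MiddleBranch
  (p * (1 - (1 - p) ^+ t)) (fun n => famV n (k n) t) hp hpq hq hkl hkp hlq).
- by nra.
- exact: cvg_mu_famV.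
- near=> n; rewrite in_itv /=; apply/andP; split; last first.
    have <- : mu R (k n) (famS n (k n) 1) = density R k n.
      by near: n; exact: (near_mu_famS1 _ _ _ hp p1 hkp).
    by apply: mu_subset; exact: famV_sub_famS1.
  (* The limiting difference p (1 - p - (1 - p)^t) is strictly positive by [e1], which uses t > 1;
     hence the difference is positive for large n. *)
  rewrite -subr_ge0 ltW//; near: n.
  have : mu R (k n) (famV n (k n) t) - density R k n * density R k n @[n --> \oo]
      --> p * (1 - (1 - p) ^+ t) - p * p.
    by apply: cvgB; [exact: cvg_mu_famV | exact: cvgM].
  by move=> /cvgr_gt; apply; nra.
(* Dividing the limit by p again leaves the base (1 - p)^t, and the branch takes the value q (1 - (1
   - q)^t). *)
rewrite /= [p * _]mulrC mulfK ?gt_eqF// subKr powR_expr_ln_ratio; [|lra|lra].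
have := cvg_mu_famV _ _ _ t q0 hq hlq.
apply: cvg_trans; apply: near_eq_cvg; near=> n => /=.
have [tk kn] : (2 <= k n)%N /\ (2 + k n <= n)%N.
  by near: n; exact: (near_density_bounds _ _ _ _ hp p1 hkp).
by rewrite upper_shadow_famV//; lia.
Unshelve. all: by end_near.
Qed.

(** * The case t = 1 and the conclusion *)

Lemma near_Theta_gap_eq (R : realType) (k l : nat -> nat)
    (F G : forall n, {set {set 'I_n}}) (y : R) :
    (\forall n \near \oo, F n = G n) ->
  Theta_gap R k l G n @[n --> \oo] --> y ->
  Theta_gap R k l F n @[n --> \oo] --> y.
Proof.
move=> FG; apply: cvg_trans; apply: near_eq_cvg.
by apply: filterS FG => n FG; rewrite /Theta_gap FG.
Qed.

Theorem proposition3p5 (R : realType) (t : nat) (p q : R) (k l : nat -> nat)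
    (ht : (1 <= t)%N) (hp : 0 < p) (hpq : p <= q) (hq : q < 1)
    (hkl : forall n : nat, (k n <= l n)%N)
    (hkp : density R k n @[n --> \oo] --> p)
    (hlq : density R l n @[n --> \oo] --> q) :
  [/\ Theta_gap R k l (fun n => famS n (k n) t) n @[n --> \oo] --> (0 : R),
      Theta_gap R k l (fun n => famV n (k n) t) n @[n --> \oo] --> (0 : R)
    & Theta_gap R k l (fun n => famU n (k n) t) n @[n --> \oo] --> (0 : R)]
  /\
  [/\ (2 <= t)%N ->
        asymptotically_attains FirstBranch p k l (fun n => famS n (k n) t),
      asymptotically_attains MiddleBranch p k l (fun n => famV n (k n) t)
    & asymptotically_attains ThirdBranch p k l (fun n => famU n (k n) t)].
Proof.
have p1 : p < 1 by exact: le_lt_trans hpq hq.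
have gU : Theta_gap R k l (fun n => famU n (k n) t) n @[n --> \oo] --> (0 : R).
  exact: (@Theta_gap_famU R p q k l t hp hpq hq hkl hkp hlq ht).
have t12 : t = 1%N \/ (1 < t)%N by lia.
have gS : Theta_gap R k l (fun n => famS n (k n) t) n @[n --> \oo] --> (0 : R).
  have [t1|t1] := t12; last first.
    exact: (@Theta_gap_famS R p q k l t hp hpq hq hkl hkp hlq t1).
  (* At t = 1 the density of S is the breakpoint k/n itself, already treated with U on the third
     branch. *)
  apply: near_Theta_gap_eq gU; near=> n; rewrite t1 famU1//.
  by near: n; exact: nbhs_infty_gt.
have gV : Theta_gap R k l (fun n => famV n (k n) t) n @[n --> \oo] --> (0 : R).
  have [t1|t1] := t12; last first.
    exact: (@Theta_gap_famV R p q k l t hp hpq hq hkl hkp hlq t1).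
  (* At t = 1 the density of V is at most (k/n)^2, so [Theta] is evaluated on the first branch
     through S with t = 2. Its limit p^2 still belongs to the middle interval. *)
  apply: near_Theta_gap_eq
    (@Theta_gap_famS R p q k l 2 hp hpq hq hkl hkp hlq isT).
  by near=> n; rewrite t1 famV1//; near: n; exact: nbhs_infty_gt.
(* The weak inequality suffices for the limits of V and U to lie in their closed intervals; at t = 1
   they are the left endpoints p^2 and p. *)
have le1 : (1 - p) ^+ t <= 1 - p by apply: ler_iXnr => //; lra.
have e0 : 0 < (1 - p) ^+ t by rewrite exprn_gt0// subr_gt0.
split=> //; split=> [t2||]; split=> //.
- by move=> n; apply/fintype.subsetP => A; rewrite !inE => /andP[].
- exists (p ^+ t); first exact: cvg_mu_famS.
  rewrite in_itv /=; apply/andP; split; first exact/exprn_ge0/ltW.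
  by apply: ler_wiXn2l => //; exact: ltW.
- by move=> n; apply/fintype.subsetP => A; rewrite !inE => /andP[].
- exists (p * (1 - (1 - p) ^+ t)); first exact: cvg_mu_famV.
  by rewrite in_itv /=; apply/andP; split; nra.
- by move=> n; apply/fintype.subsetP => A; rewrite !inE => /andP[].
- exists (1 - (1 - p) ^+ t); first exact: cvg_mu_famU.
  by rewrite in_itv /=; apply/andP; split; lra.
Unshelve. all: by end_near.
Qed.
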